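(* Let $G$ be a finite simple connected graph on $n$ vertices, and let $m$ be a positive integer with $m\leq n$. Then there exists an $m$-partite spanning subgraph $H$ of $G$ such that $$\left(1-\frac{1}{m}\right)d_G(v)\leq d_H(v)\quad\text{for all } v\in V(G).$$
   Context: $d_G(v)$ and $d_H(v)$ denote the degree of the vertex $v$ in $G$ and in $H$ respectively. A spanning subgraph of $G$ is a subgraph with the same vertex set $V(G)$ (it is not required to be connected). A graph is $m$-partite if its vertex set can be partitioned into $m$ classes such that no edge has both endpoints in the same class. *)

(* Defs.v *)
From mathcomp Require Import all_boot all_order all_algebra.

Set Implicit Arguments.
Unset Strict Implicit.
Unset Printing Implicit Defensive.

(* A graph with vertex set T is given by its adjacency relation. *)
Definition simple_graph (T : finType) (e : rel T) : Prop :=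
  symmetric e /\ irreflexive e.

Definition connected_graph (T : finType) (e : rel T) : Prop :=
  forall x y : T, connect e x y.

Definition degree (T : finType) (e : rel T) (v : T) : nat :=
  #|[set w | e v w]|.

(* Both graphs live on the same type T, so spanning is automatic. *)
Definition spanning_subgraph (T : finType) (h g : rel T) : Prop :=
  simple_graph h /\ subrel h g.

(* The blocks of a MathComp [partition] are nonempty, so there are exactly m
   nonempty classes; for m = 0 this would force T to be empty. *)
Definition partite (T : finType) (m : nat) (e : rel T) : Prop :=
  exists P : {set {set T}},
    [/\ partition P [set: T], #|P| = m
      & forall A, A \in P -> {in A &, forall x y, ~~ e x y}].

(* Main.v *)
Require Import Defs.
From mathcomp Require Import all_boot all_order all_algebra.
Import Order.TTheory GRing.Theory Num.Theory.

(** Among the colourings of the vertices that use all [m] colours, take one,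
    [f], with the fewest monochromatic edges, and let [H] keep the edges of [G]
    whose ends have different colours.  The subgraph [H] is [m]-partite with
    the colour classes as blocks, and [d_H(v) = d_G(v) - s], where [s] counts
    the neighbours of [v] that share its colour.

    Minimality says that no colour [j] occurs among the neighbours of [v] fewer
    than [s] times: otherwise recolouring [v] with [j] would change only the
    edges at [v] and would leave fewer monochromatic ones
    ([recolor_mono_pairs]).  The new colouring still uses every colour, because
    [s] is then positive, so that the old colour of [v] survives on a neighbour
    ([recolor_surjb]).  Summing over the [m] colours gives [m * s <= d_G(v)]
    ([exists_balanced_coloring]), which is the required bound. *)

Section Coloring.

Variables (T : finType) (m : nat).

Definition surjb (f : {ffun T -> 'I_m}) : bool :=
  [forall j, exists x, f x == j].

Definition color_degree (g : rel T) (f : {ffun T -> 'I_m}) (v : T) (j : 'I_m) :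
    nat :=
  \sum_y (g v y && (f y == j)).

(** Ordered pairs are counted, so this is twice the number of monochromatic
    edges; that keeps the sum symmetric and free of quotients. *)
Definition mono_pairs (g : rel T) (f : {ffun T -> 'I_m}) : nat :=
  \sum_x \sum_y (g x y && (f y == f x)).

Definition recolor (f : {ffun T -> 'I_m}) (v : T) (j : 'I_m) :
    {ffun T -> 'I_m} :=
  [ffun x => if x == v then j else f x].

Lemma exists_surjb : 0 < m -> m <= #|T| -> exists f, surjb f.
Proof.
move=> m_gt0 lemT.
(* The ranks beyond the last colour get the default colour 0. *)
exists [ffun x => insubd (Ordinal m_gt0) (enum_rank x : nat)].
apply/forallP=> j; apply/existsP; exists (enum_val (widen_ord lemT j)).
by rewrite ffunE enum_valK /= valKd.
Qed.

(** A neighbour of [v] with the old colour of [v] keeps that colour in use. *)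
Lemma recolor_surjb (g : rel T) f v j :
  irreflexive g -> 0 < color_degree g f v (f v) -> surjb f ->
  surjb (recolor f v j).
Proof.
move=> girr; rewrite lt0n sum_nat_eq0 negb_forall => /existsP[y].
rewrite /= eqb0 negbK => /andP[gvy /eqP fy] /forallP fsurj.
have neq_yv : y != v by apply: contraTneq gvy => ->; rewrite girr.
apply/forallP=> k; apply/existsP.
have /existsP[x /eqP fx] := fsurj k.
have [eq_xv | neq_xv] := eqVneq x v.
  by exists y; rewrite ffunE (negPf neq_yv) fy -eq_xv fx.
by exists x; rewrite ffunE (negPf neq_xv) fx.
Qed.

Lemma color_degree_recolor (g : rel T) f v j k :
  irreflexive g -> color_degree g (recolor f v j) v k = color_degree g f v k.
Proof.
move=> girr; apply: eq_bigr => y _; rewrite ffunE.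
by case: (y =P v) => // ->; rewrite girr.
Qed.

(** A monochromatic edge at [v] contributes the two pairs in which [v] comes
    first and second, hence the factor 2. *)
Lemma mono_pairs_split (g : rel T) f v :
  symmetric g -> irreflexive g ->
  mono_pairs g f = 2 * color_degree g f v (f v)
    + \sum_(x | x != v) \sum_(y | y != v) (g x y && (f y == f x)).
Proof.
move=> gsym girr; rewrite /mono_pairs (bigD1 v) //= mul2n -addnn -addnA.
congr (_ + _).
under eq_bigr => x _ do rewrite (bigD1 v) //=.
rewrite big_split /=; congr (_ + _).
rewrite /color_degree [RHS](bigD1 v) //= girr add0n.
by apply: eq_bigr => x _; rewrite gsym eq_sym.
Qed.

(** Both sides count the pairs away from [v] in the same way, so moving the
    two [color_degree] terms across avoids truncated subtraction. *)
Lemma recolor_mono_pairs (g : rel T) f v j :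
  symmetric g -> irreflexive g ->
  mono_pairs g (recolor f v j) + 2 * color_degree g f v (f v) =
  mono_pairs g f + 2 * color_degree g f v j.
Proof.
move=> gsym girr; rewrite !(mono_pairs_split _ _ v) //.
rewrite color_degree_recolor // ffunE eqxx addnAC [RHS]addnAC.
rewrite [2 * _ + 2 * _]addnC; congr (_ + _).
apply: eq_bigr => x neq_xv; apply: eq_bigr => y neq_yv.
by rewrite !ffunE (negPf neq_xv) (negPf neq_yv).
Qed.

Lemma sum_color_degree (g : rel T) f v :
  \sum_j color_degree g f v j = degree g v.
Proof.
rewrite exchange_big /= /degree -sum1dep_card [RHS]big_mkcond /=.
apply: eq_bigr => y _; rewrite (bigD1 (f y)) //= eqxx andbT big1.
  by rewrite addn0; case: (g v y).
by move=> j; rewrite eq_sym => /negPf ->; rewrite andbF.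
Qed.

(** The colouring is one with the fewest monochromatic edges: every colour is
    then at least as frequent around [v] as the colour of [v]. *)
Lemma exists_balanced_coloring (g : rel T) :
  simple_graph g -> 0 < m -> m <= #|T| ->
  exists2 f, surjb f & forall v, m * color_degree g f v (f v) <= degree g v.
Proof.
move=> [gsym girr] m_gt0 lemT; have [f0 f0surj] := exists_surjb m_gt0 lemT.
case: (arg_minnP (mono_pairs g) f0surj) => f fsurj fmin.
exists f => // v.
rewrite -(sum_color_degree g f v) -[m in m * _]card_ord -sum_nat_const.
apply: leq_sum => j _; rewrite leqNgt; apply/negP=> ltj.
have := fmin _ (recolor_surjb g f v j girr (leq_ltn_trans (leq0n _) ltj) fsurj).
rewrite -(leq_add2r (2 * color_degree g f v (f v))) recolor_mono_pairs //.
by rewrite leq_add2l leq_pmul2l // leqNgt ltj.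
Qed.

Definition bichromatic (g : rel T) (f : {ffun T -> 'I_m}) : rel T :=
  fun x y => g x y && (f y != f x).

Lemma spanning_bichromatic (g : rel T) f :
  simple_graph g -> spanning_subgraph (bichromatic g f) g.
Proof.
move=> [gsym girr]; split; last by move=> x y /andP[].
split=> [x y | x]; first by rewrite /bichromatic gsym eq_sym.
by rewrite /bichromatic girr.
Qed.

(** Surjectivity makes the colour classes nonempty, hence also pairwise
    distinct, so that there are exactly [m] of them. *)
Lemma partite_bichromatic (g : rel T) f :
  surjb f -> partite m (bichromatic g f).
Proof.
move=> /forallP fsurj; pose cls (j : 'I_m) := [set x | f x == j].
have cls_inj : injective cls.
  move=> j k eq_jk; have /existsP[x fx] := fsurj j.
  by have := fx; rewrite -[_ == j](in_set (fun x => f x == j)) -/(cls j) eq_jk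
    inE (eqP fx) => /eqP.
exists [set cls j | j : 'I_m]; split.
- apply/and3P; split.
  + rewrite eqEsubset subsetT /=; apply/subsetP=> x _.
    by apply/bigcupP; exists (cls (f x)); rewrite ?imset_f ?inE.
  + apply/trivIsetP=> _ _ /imsetP[j _ ->] /imsetP[k _ ->] neq_jk.
    rewrite -setI_eq0; apply: contraNT neq_jk => /set0Pn[x].
    by rewrite !inE => /andP[/eqP <- /eqP <-].
  + apply/imsetP=> -[j _ eq0]; have /existsP[x fx] := fsurj j.
    by have := in_set0 x; rewrite eq0 inE fx.
- by rewrite card_imset // card_ord.
- move=> _ /imsetP[j _ ->] x y; rewrite !inE => /eqP fx /eqP fy.
  by rewrite /bichromatic fx fy eqxx andbF.
Qed.

Lemma degree_bichromatic (g : rel T) f v :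
  degree g v = degree (bichromatic g f) v + color_degree g f v (f v).
Proof.
rewrite /degree -!sum1dep_card ![\sum_(_ | _) 1]big_mkcond -big_split /=.
apply: eq_bigr => y _; rewrite /bichromatic.
by case: (g v y); case: (f y == f v).
Qed.

End Coloring.

Local Open Scope ring_scope.

Theorem lemma6 (T : finType) (g : rel T) (n m : nat)
    (hsimple : simple_graph g) (hconn : connected_graph g)
    (hn : #|T| = n) (hm0 : (0 < m)%N) (hmn : (m <= n)%N) :
  exists h : rel T,
    [/\ spanning_subgraph h g, partite m h
      & forall v : T,
          (1 - 1 / m%:R) * (degree g v)%:R <= (degree h v)%:R :> rat].
Proof.
rewrite -hn in hmn.
have [f fsurj fbal] := exists_balanced_coloring T m g hsimple hm0 hmn.
exists (bichromatic T m g f); split.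
- exact: spanning_bichromatic.
- exact: partite_bichromatic.
move=> v; have := fbal v; rewrite -(ler_nat rat) natrM => le_deg.
have m_gt0 : 0 < m%:R :> rat by rewrite ltr0n.
rewrite mulrBl !mul1r lerBlDr [in leLHS](degree_bichromatic T m g f v).
by rewrite natrD lerD2l mulrC ler_pdivlMr // mulrC.
Qed.
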